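(* Let $E$ be the $2$-dimensional Euclidean space and let $\rho$ be a norm on $E$ whose closed unit ball $\bar B_\rho(0,1)$ is the convex hull of a finite number of points. Then the problem $$\inf\{\rho(x_0-x)+\rho^*(x):\ x\in E\}$$ admits a unique solution for all $x_0\in E$ if and only if the set $$W=\left\{(x_1,x_2,x_3)\in\mathcal{V}\times\mathcal{V}\times\mathcal{V}:\ [x_2,x_3]\subset\partial\bar B_\rho(0,1),\ x_2\neq x_3,\ x_1\cdot(x_2-x_3)=0\right\}$$ is empty, where $\mathcal{V}$ is the set of extreme points of $\bar B_\rho(0,1)$.
   Context: The scalar product of $E$ is denoted $x\cdot y$. $\bar B_\rho(0,1)=\{x\in E:\rho(x)\le 1\}$ and $\partial\bar B_\rho(0,1)=\{x\in E:\rho(x)=1\}$. The Legendre transform of $\rho$ is $\rho^*(y)=\sup\{x\cdot y-\rho(x):x\in E\}\in[0,\infty]$. A solution of the problem is a point $x\in E$ attaining the infimum. For $p,q\in E$, $[p,q]=\{p+t(q-p):t\in[0,1]\}$. A point $x\in\Omega\subset E$ is an extreme point of $\Omega$ if $2x=x_1+x_2$ with $x_1,x_2\in\Omega$ implies $x=x_1=x_2$. *)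

(* Defs.v *)
From mathcomp Require Import all_boot all_order all_algebra.
From mathcomp Require Import all_classical all_reals all_analysis.

Set Implicit Arguments.
Unset Strict Implicit.
Unset Printing Implicit Defensive.

Import Order.TTheory GRing.Theory Num.Theory.

Local Open Scope classical_set_scope.
Local Open Scope ring_scope.

Definition dot (R : realType) (n : nat) (x y : 'rV[R]_n) : R :=
  \sum_(i < n) x 0 i * y 0 i.

(* A norm as a predicate on functions: rho is unrelated to the canonical
   (sup) norm `|x| that the library puts on 'rV[R]_n. *)
Definition is_norm (R : realType) (E : lmodType R) (rho : E -> R) : Prop :=
  [/\ forall x y, rho (x + y) <= rho x + rho y,
      forall (a : R) x, rho (a *: x) = `|a| * rho x
    & forall x, rho x = 0 -> x = 0].

Definition unit_ball (R : realType) (E : lmodType R) (rho : E -> R) : set E :=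
  [set x | rho x <= 1].

Definition unit_sphere (R : realType) (E : lmodType R) (rho : E -> R) : set E :=
  [set x | rho x = 1].

Definition convex_hull (R : realType) (E : lmodType R) (A : set E) : set E :=
  smallest (@convex_set R E) A.

Definition segment (R : realType) (E : lmodType R) (p q : E) : set E :=
  [set p + t *: (q - p) | t in `[(0 : R), 1]].

Definition extreme_points (R : realType) (E : lmodType R) (A : set E) : set E :=
  [set x | A x /\ forall x1 x2, A x1 -> A x2 ->
                    x *+ 2 = x1 + x2 -> x = x1 /\ x = x2].

Definition legendre (R : realType) (n : nat) (rho : 'rV[R]_n -> R)
    (y : 'rV[R]_n) : \bar R :=
  ereal_sup (range (fun x => (dot x y - rho x)%:E)).

Definition objective (R : realType) (n : nat) (rho : 'rV[R]_n -> R)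
    (x0 x : 'rV[R]_n) : \bar R :=
  ((rho (x0 - x))%:E + legendre rho x)%E.

Definition is_solution (R : realType) (n : nat) (rho : 'rV[R]_n -> R)
    (x0 x : 'rV[R]_n) : Prop :=
  objective rho x0 x = ereal_inf (range (objective rho x0)).

Definition W_set (R : realType) (n : nat) (rho : 'rV[R]_n -> R)
    : set ('rV[R]_n * 'rV[R]_n * 'rV[R]_n) :=
  let V := extreme_points (unit_ball rho) in
  [set w | let: (x1, x2, x3) := w in
    [/\ V x1, V x2 & V x3] /\
    [/\ segment x2 x3 `<=` unit_sphere rho, x2 <> x3 & dot x1 (x2 - x3) = 0]].

(* Main.v *)
Require Import Defs.
From mathcomp Require Import all_boot all_order all_algebra.
From mathcomp Require Import all_classical all_reals all_analysis.
From mathcomp Require Import ring lra.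

Import Order.TTheory GRing.Theory Num.Theory numFieldNormedType.Exports.

(** Since [rho] is a norm, [rho^*] vanishes on the dual ball
    [K = {y | x . y <= rho x for all x}] and is infinite elsewhere, so the
    problem asks for the points of [K] that are [rho]-nearest to [x0].  One
    exists by compactness of [K].  It can only fail to be unique when an edge of
    [K] is parallel to an edge of the unit ball [B], and [W_set rho] records
    exactly this: the edges of [K] lie on the lines [{y | x1 . y = 1}] with [x1]
    a vertex of [B], so that [x1 . (x2 - x3) = 0] says that the edge of [K]
    carried by [x1] is parallel to the edge [[x2, x3]] of [B].

    Two nearest points give parallel edges ([W_set_of_two_nearest]).  If [x] and
    [y] are both nearest to [x0], so is the whole segment between them; seen
    from [x0] and rescaled, it is a flat piece of the unit sphere, which extends
    to a segment of the sphere with extreme ends [x2] and [x3] ([flat_edge]).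
    The midpoint of [x] and [y] is on the boundary of [K], otherwise it could be
    moved towards [x0]; hence some [b] in [B] has value [1] at the midpoint
    ([nearest_touches]), so also at [x] and at [y].  Having maximal value on two
    independent vectors makes [b] extreme ([extreme_of_two_contacts]), and
    [b . (x - y) = 0].

    Parallel edges give two nearest points ([two_nearest_of_W_set]).  As [B] is
    a polygon, its vertex [x1] carries a nondegenerate edge
    [[p, p + s (x2 - x3)]] of [K] ([dual_edge]).  For [x0 = p + s x2], the
    vectors from the two ends of this edge to [x0] are [s x2] and [s x3], both
    of norm [s]; the functional with value [1] on the line through [x2] and
    [x3] is a multiple of [x1], which keeps [K] at distance at least [s] from [x0]
    when that multiple is positive.  When it is negative, [x0 = p - s x3] does
    the same on the other side. *)

Set Implicit Arguments.
Unset Strict Implicit.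

Local Open Scope classical_set_scope.
Local Open Scope ring_scope.

Lemma between_le (R : realFieldType) (a b c t : R) :
  0 <= t <= 1 -> a <= c -> b <= c -> a + t * (b - a) <= c.
Proof.
move=> /andP[t0 t1]; rewrite -(subr_ge0 a) -(subr_ge0 b) => ha hb.
have /(mulr_ge0 t0) := hb; have : 0 <= 1 - t by lra.
by move=> /mulr_ge0 /(_ ha); lra.
Qed.

(** * The scalar product in the plane *)

Lemma dotC (R : realType) (n : nat) (x y : 'rV[R]_n) : dot x y = dot y x.
Proof. by apply: eq_bigr => i _; rewrite mulrC. Qed.

Lemma dotDl (R : realType) (n : nat) (x y z : 'rV[R]_n) :
  dot (x + y) z = dot x z + dot y z.
Proof. by rewrite -big_split; apply: eq_bigr => i _; rewrite mxE mulrDl. Qed.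

Lemma dotZl (R : realType) (n : nat) (a : R) (x z : 'rV[R]_n) :
  dot (a *: x) z = a * dot x z.
Proof. by rewrite mulr_sumr; apply: eq_bigr => i _; rewrite mxE mulrA. Qed.

Lemma dot0l (R : realType) (n : nat) (z : 'rV[R]_n) : dot 0 z = 0.
Proof. by rewrite -(scale0r 0) dotZl mul0r. Qed.

Lemma dotNl (R : realType) (n : nat) (x z : 'rV[R]_n) :
  dot (- x) z = - dot x z.
Proof. by rewrite -scaleN1r dotZl mulN1r. Qed.

Lemma dotDr (R : realType) (n : nat) (x y z : 'rV[R]_n) :
  dot z (x + y) = dot z x + dot z y.
Proof. by rewrite dotC dotDl !(dotC z). Qed.

Lemma dotZr (R : realType) (n : nat) (a : R) (x z : 'rV[R]_n) :
  dot z (a *: x) = a * dot z x.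
Proof. by rewrite dotC dotZl (dotC z). Qed.

Lemma dot0r (R : realType) (n : nat) (z : 'rV[R]_n) : dot z 0 = 0.
Proof. by rewrite dotC dot0l. Qed.

Lemma dotNr (R : realType) (n : nat) (x z : 'rV[R]_n) :
  dot z (- x) = - dot z x.
Proof. by rewrite dotC dotNl (dotC z). Qed.

Definition dotE := (dotDl, dotDr, dotZl, dotZr, dotNl, dotNr).

Lemma dot2E (R : realType) (x y : 'rV[R]_2) :
  dot x y = x 0 0 * y 0 0 + x 0 1 * y 0 1.
Proof.
rewrite /dot !big_ord_recl big_ord0 addr0.
by congr (_ + x 0 _ * y 0 _); exact/val_inj.
Qed.

Lemma row2P (R : realType) (x y : 'rV[R]_2) :
  x 0 0 = y 0 0 -> x 0 1 = y 0 1 -> x = y.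
Proof.
move=> h0 h1; apply/rowP => -[[|[|//]] hi].
  by rewrite (_ : Ordinal hi = 0) //; exact/val_inj.
by rewrite (_ : Ordinal hi = 1) //; exact/val_inj.
Qed.

Lemma dot2_gt0 (R : realType) (x : 'rV[R]_2) : x <> 0 -> 0 < dot x x.
Proof.
move=> x0; rewrite dot2E lt_neqAle addr_ge0 -?expr2 ?sqr_ge0 // andbT eq_sym.
apply/negP; rewrite paddr_eq0 ?sqr_ge0 // !sqrf_eq0 => /andP[/eqP h0 /eqP h1].
by apply: x0; apply: row2P; rewrite mxE.
Qed.

(** In the plane the vectors orthogonal to a nonzero [n] form a line: the
    determinant of [u] and [w], times either coordinate of [n], is a combination
    of the two scalar products. *)
Lemma orthogonal_collinear (R : realType) (n u w : 'rV[R]_2) :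
  n <> 0 -> w <> 0 -> dot n u = 0 -> dot n w = 0 -> exists t, u = t *: w.
Proof.
move=> n0 w0; rewrite !dot2E => nu nw.
have det : u 0 0 * w 0 1 - u 0 1 * w 0 0 = 0.
  apply/eqP; apply: contrapT => /negP d0; apply: n0; apply: row2P; rewrite mxE.
    apply/eqP; rewrite -(mulIr_eq0 _ (mulIf d0)); apply/eqP.
    transitivity ((n 0 0 * u 0 0 + n 0 1 * u 0 1) * w 0 1
      - (n 0 0 * w 0 0 + n 0 1 * w 0 1) * u 0 1); first by ring.
    by rewrite nu nw; ring.
  apply/eqP; rewrite -(mulIr_eq0 _ (mulIf d0)); apply/eqP.
  transitivity ((n 0 0 * w 0 0 + n 0 1 * w 0 1) * u 0 0
    - (n 0 0 * u 0 0 + n 0 1 * u 0 1) * w 0 0); first by ring.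
  by rewrite nu nw; ring.
have ww := lt0r_neq0 (@dot2_gt0 _ _ w0).
exists (dot u w / dot w w); apply: row2P; rewrite mxE; apply: (mulIf ww).
  rewrite mulrAC divfK // !dot2E.
  transitivity ((u 0 0 * w 0 0 + u 0 1 * w 0 1) * w 0 0
    + (u 0 0 * w 0 1 - u 0 1 * w 0 0) * w 0 1); first by ring.
  by rewrite det; ring.
rewrite mulrAC divfK // !dot2E.
transitivity ((u 0 0 * w 0 0 + u 0 1 * w 0 1) * w 0 1
  - (u 0 0 * w 0 1 - u 0 1 * w 0 0) * w 0 0); first by ring.
by rewrite det; ring.
Qed.

Lemma exists_normal (R : realType) (w : 'rV[R]_2) :
  w <> 0 -> exists2 n, n <> 0 & dot n w = 0.
Proof.
move=> w0; exists (\row_i (if i == 0 then - w 0 1 else w 0 0)).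
  move=> /rowP h; apply: w0; apply: row2P; rewrite mxE.
    by have := h 1; rewrite !mxE.
  by have := h 0; rewrite !mxE /= => /eqP; rewrite oppr_eq0 => /eqP.
by rewrite dot2E !mxE /=; ring.
Qed.

(** * The dual ball and the reduction to a nearest-point problem *)

Section NormFacts.

Context (R : realType) (n : nat) (rho : 'rV[R]_n -> R) (rho_norm : is_norm rho).

Lemma is_norm0 : rho 0 = 0.
Proof. by case: rho_norm => _ h _; rewrite -(scale0r 0) h normr0 mul0r. Qed.

Lemma is_normD (x y : 'rV[R]_n) : rho (x + y) <= rho x + rho y.
Proof. by case: rho_norm. Qed.

Lemma is_normZ a (x : 'rV[R]_n) : rho (a *: x) = `|a| * rho x.
Proof. by case: rho_norm. Qed.

Lemma is_normN (x : 'rV[R]_n) : rho (- x) = rho x.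
Proof. by rewrite -scaleN1r is_normZ normrN1 mul1r. Qed.

Lemma is_norm_ge0 (x : 'rV[R]_n) : 0 <= rho x.
Proof. by have := is_normD x (- x); rewrite subrr is_norm0 is_normN; lra. Qed.

Lemma is_norm_gt0 (x : 'rV[R]_n) : x <> 0 -> 0 < rho x.
Proof.
move=> x0; rewrite lt_neqAle is_norm_ge0 andbT eq_sym.
apply/eqP => h; apply: x0.
by case: rho_norm => _ _; apply.
Qed.

End NormFacts.

Definition dual_ball (R : realType) (n : nat) (rho : 'rV[R]_n -> R) :
  set 'rV[R]_n := [set y | forall x, dot x y <= rho x].

Lemma dual_ball0 (R : realType) (n : nat) (rho : 'rV[R]_n -> R) :
  is_norm rho -> dual_ball rho 0.
Proof. by move=> h x; rewrite dot0r is_norm_ge0. Qed.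

Lemma dual_ball_convex (R : realType) (n : nat) (rho : 'rV[R]_n -> R)
    (x y : 'rV[R]_n) (t : R) :
  0 <= t <= 1 -> dual_ball rho x -> dual_ball rho y ->
  dual_ball rho (x + t *: (y - x)).
Proof.
move=> t01 hx hy b; rewrite !dotE.
by apply: between_le; [|exact: hx|exact: hy].
Qed.

Lemma legendre_in (R : realType) (n : nat) (rho : 'rV[R]_n -> R) y :
  is_norm rho -> dual_ball rho y -> legendre rho y = 0%E.
Proof.
move=> hr hy; apply/eqP; rewrite eq_le; apply/andP; split.
  apply: ge_ereal_sup => _ [x _ <-]; rewrite lee_fin subr_le0; exact: hy.
by apply: ereal_sup_ubound; exists 0 => //; rewrite dot0l is_norm0 // subrr.
Qed.

Lemma legendre_notin (R : realType) (n : nat) (rho : 'rV[R]_n -> R) y :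
  is_norm rho -> ~ dual_ball rho y -> legendre rho y = +oo%E.
Proof.
move=> hr /existsNP[x /negP]; rewrite -ltNge => hx.
(* Scaling a vector that violates the dual bound makes the supremum
   infinite. *)
have ub k : 0 <= k -> ((k * (dot x y - rho x))%:E <= legendre rho y)%E.
  move=> k0; apply: ereal_sup_ubound; exists (k *: x) => //.
  by rewrite dotZl is_normZ // ger0_norm // mulrBr.
case E : (legendre rho y) => [r|//|].
- have r0 := ub 0 (lexx _); rewrite E mul0r lee_fin in r0.
  have c0 : 0 < dot x y - rho x by rewrite subr_gt0.
  have := ub ((r + 1) / (dot x y - rho x)).
  rewrite E lee_fin divfK ?gt_eqF // divr_ge0 ?(ltW c0) //; last lra.
  by move=> /(_ erefl); rewrite gerDl ler10.
- by have := ub 0 (lexx _); rewrite E.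
Qed.

Definition nearest (R : realType) (n : nat) (rho : 'rV[R]_n -> R)
    (x0 x : 'rV[R]_n) : Prop :=
  dual_ball rho x /\
  forall z, dual_ball rho z -> rho (x0 - x) <= rho (x0 - z).

(** The origin belongs to the dual ball, so the infimum is finite and a solution
    cannot lie where the Legendre transform is infinite. *)
Lemma is_solutionE (R : realType) (n : nat) (rho : 'rV[R]_n -> R) x0 x :
  is_norm rho -> is_solution rho x0 x <-> nearest rho x0 x.
Proof.
move=> hr; rewrite /is_solution /objective; split=> [h|[hx hmin]].
  have hle z : ((rho (x0 - x))%:E + legendre rho x
             <= (rho (x0 - z))%:E + legendre rho z)%E.
    by rewrite h; apply: ereal_inf_lbound; exists z.
  have hx : dual_ball rho x.
    apply: contrapT => hx; have := hle 0.
    by rewrite legendre_notin // (legendre_in hr (dual_ball0 hr)).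
  split=> // z hz; have := hle z.
  by rewrite !legendre_in // !adde0 lee_fin.
apply/eqP; rewrite eq_le; apply/andP; split; last first.
  by apply: ereal_inf_lbound; exists x.
apply: le_ereal_inf_tmp => _ [z _ <-]; rewrite legendre_in // adde0.
have [hz|hz] := pselect (dual_ball rho z).
  by rewrite legendre_in // adde0 lee_fin hmin.
by rewrite legendre_notin // addeC /= leey.
Qed.

Lemma row_coord_le_norm (R : realType) (n : nat) (x : 'rV[R]_n) i :
  `|x 0 i| <= `|x|.
Proof.
rewrite [leRHS]/Num.norm /= mx_normrE.
by apply/bigmax_geP; right => /=; exists (0, i).
Qed.

Lemma is_norm_lipschitz (R : realType) (n : nat) (rho : 'rV[R]_n -> R) :
  is_norm rho -> exists2 C, 0 < C & forall x, rho x <= C * `|x|.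
Proof.
move=> hr; have [h1 h2 _] := hr.
have S0 : 0 <= \sum_(i < n) rho (delta_mx 0 i).
  by apply: sumr_ge0 => i _; exact: is_norm_ge0.
exists (1 + \sum_(i < n) rho (delta_mx 0 i)) => [|x]; first lra.
suff : rho x <= (\sum_(i < n) rho (delta_mx 0 i)) * `|x|.
  by have := normr_ge0 x; lra.
rewrite mulr_suml [in leLHS](row_sum_delta x).
apply: (big_ind2 (fun u v => rho u <= v)) => [|u1 v1 u2 v2 a1 a2|i _].
- by rewrite is_norm0.
- by apply: le_trans (h1 _ _) _; rewrite lerD.
- by rewrite h2 mulrC ler_wpM2l ?is_norm_ge0 // row_coord_le_norm.
Qed.

Lemma is_norm_continuous (R : realType) (n : nat) (rho : 'rV[R]_n -> R) :
  is_norm rho -> continuous rho.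
Proof.
move=> hr x; have [C C0 hC] := is_norm_lipschitz hr.
apply/(@cvgrPdist_le _ _ _ (nbhs x)) => e e0;
apply/(@nbhs_normP R 'rV[R]_n); exists (e / C); first exact: divr_gt0.
move=> y /= /ltW xy.
have hxy : rho x - rho y <= rho (x - y).
  by have := is_normD hr (x - y) y; rewrite subrK; lra.
have hyx : rho y - rho x <= rho (x - y).
  have := is_normD hr (y - x) x; have := is_normN hr (y - x).
  by rewrite subrK opprB; lra.
have : rho (x - y) <= e.
  by apply: le_trans (hC _) _; rewrite -ler_pdivlMl // mulrC.
by move=> ?; rewrite /= ler_norml; lra.
Qed.

(** Testing the dual bound on the vectors of the standard basis and on their
    opposites bounds every coordinate; closedness holds because the dual ball is
    an intersection of closed half-spaces. *)
Lemma dual_ball_compact (R : realType) (n : nat) (rho : 'rV[R]_n -> R) :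
  is_norm rho -> compact (dual_ball rho).
Proof.
move=> hr; apply: bounded_closed_compact.
  have [C C0 hC] := is_norm_lipschitz hr.
  exists C; split; first by rewrite num_real.
  move=> M CM y hy; rewrite /= [leLHS]/Num.norm /= mx_normrE.
  apply/bigmax_leP; split=> [|[i j] _ /=]; first lra.
  have d1 : `|delta_mx 0 j : 'rV[R]_n| <= 1.
    rewrite [leLHS]/Num.norm /= mx_normrE.
    apply/bigmax_leP; split=> // -[k l] _ /=.
    by rewrite mxE; case: (_ && _); rewrite ?normr1 ?normr0.
  have dE : dot (delta_mx 0 j) y = y 0 j.
    rewrite /dot (bigD1 j) //= big1 => [|k kj];
      last by rewrite mxE (negbTE kj) andbF mul0r.
    by rewrite mxE !eqxx mul1r addr0.
  rewrite (ord1 i) ler_norml -dE lerNl -dotNl.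
  have hd : rho (delta_mx 0 j) <= M.
    by apply: le_trans (hC _) _; nra.
  by rewrite !(le_trans (hy _)) ?is_normN.
have -> : dual_ball rho =
    \bigcap_(x in setT) ((fun y => dot x y) @^-1` [set r | r <= rho x]).
  by apply/seteqP; split=> y hy x; [move=> _|]; exact: hy.
apply: closed_bigI => x _; apply: preimage_closed; last exact: closed_le.
move=> y _; apply: (@continuous_big R _ _ _ _ add_continuous) => i _ {}y.
apply: (@cvgM _ _ (nbhs y)); [exact: cvg_cst|exact: coord_continuous].
Qed.

Lemma exists_nearest (R : realType) (n : nat) (rho : 'rV[R]_n -> R) x0 :
  is_norm rho -> exists x, nearest rho x0 x.
Proof.
move=> hr.
have K0 : dual_ball rho !=set0 by exists 0; exact: dual_ball0.
have cdist : {within dual_ball rho, continuous (fun x => rho (x0 - x))}.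
  apply: continuous_subspaceT => x.
  apply: (@continuous_comp _ _ _ (fun x : 'rV[R]_n => x0 - x) rho);
    last exact: is_norm_continuous.
  by apply: (@cvgB _ _ _ (nbhs x)); [exact: cvg_cst|exact: cvg_id].
have [x /set_mem hx hm] := compact_EVT_min K0 (dual_ball_compact hr) cdist.
by exists x; split=> // z hz; apply: hm; exact: mem_set.
Qed.

Ltac row_ring := apply/rowP => ?; rewrite !mxE; ring.

(** * Flat pieces of the unit sphere *)

Lemma is_norm_between_le (R : realType) (n : nat) (rho : 'rV[R]_n -> R)
    (p q : 'rV[R]_n) (c t : R) :
  is_norm rho -> 0 <= t <= 1 -> rho p <= c -> rho q <= c ->
  rho (p + t *: (q - p)) <= c.
Proof.
move=> hr /andP[t0 t1] hp hq.
have -> : p + t *: (q - p) = (1 - t) *: p + t *: q by row_ring.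
apply: le_trans (is_normD hr _ _) _.
rewrite !(is_normZ hr) !ger0_norm //; last lra.
have := between_le (t := t) _ hp hq; rewrite t0 t1 => /(_ erefl); lra.
Qed.

Lemma segment_sphereP (R : realType) (n : nat) (rho : 'rV[R]_n -> R)
    (p q : 'rV[R]_n) :
  segment p q `<=` unit_sphere rho <->
  forall t, 0 <= t <= 1 -> rho (p + t *: (q - p)) = 1.
Proof.
split=> [h t t01|h _ [t /= t01 <-]].
  by apply: h; exists t => //=; rewrite in_itv.
by apply: h; rewrite in_itv in t01.
Qed.

Lemma segment_sphere_ends (R : realType) (n : nat) (rho : 'rV[R]_n -> R)
    (p q : 'rV[R]_n) :
  segment p q `<=` unit_sphere rho -> rho p = 1 /\ rho q = 1.
Proof.
move=> /segment_sphereP h; split.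
  by have := h 0; rewrite scale0r addr0; apply; rewrite lexx ler01.
by have := h 1; rewrite scale1r addrC subrK; apply; rewrite lexx ler01.
Qed.

Lemma segment_sphereC (R : realType) (n : nat) (rho : 'rV[R]_n -> R)
    (p q : 'rV[R]_n) :
  segment p q `<=` unit_sphere rho -> segment q p `<=` unit_sphere rho.
Proof.
move=> /segment_sphereP h; apply/segment_sphereP => t t01.
have -> : q + t *: (p - q) = p + (1 - t) *: (q - p) by row_ring.
by apply: h; lra.
Qed.

(** The function [t |-> rho (p + t (q - p))] is convex and equal to [1] on
    [[0, 1]], so it is at least [1] on the whole line; the general case follows
    by homogeneity.  In other words the linear form with value [1] on the line
    through [p] and [q] supports the unit ball. *)
Lemma flat_lower_bound (R : realType) (n : nat) (rho : 'rV[R]_n -> R)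
    (p q : 'rV[R]_n) (a b : R) :
  is_norm rho -> segment p q `<=` unit_sphere rho ->
  a <= rho (a *: p + b *: (q - p)).
Proof.
move=> hr hs; have [rp rq] := segment_sphere_ends hs.
have [a0|a0] := leP a 0; first by apply: le_trans a0 (is_norm_ge0 hr _).
(* When [b / a] is outside [[0, 1]], one end of the segment is a convex
   combination of the other end and of the rescaled point. *)
have [b0|b0] := ltP b 0.
  have := is_normD hr (a *: p + b *: (q - p)) (- b *: q).
  have -> : a *: p + b *: (q - p) + - b *: q = (a - b) *: p by row_ring.
  by rewrite !(is_normZ hr) rp rq !ger0_norm; lra.
have [ab|ab] := ltP a b.
  have := is_normD hr (a *: p + b *: (q - p)) ((b - a) *: p).
  have -> : a *: p + b *: (q - p) + (b - a) *: p = b *: q by row_ring.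
  by rewrite !(is_normZ hr) rp rq !ger0_norm; lra.
have -> : a *: p + b *: (q - p) = a *: (p + (b / a) *: (q - p)).
  by rewrite [RHS]scalerDr scalerA mulrCA divff ?mulr1 // gt_eqF.
move/segment_sphereP: hs => hs.
rewrite (is_normZ hr) hs; first by rewrite mulr1 ler_norm.
by rewrite divr_ge0 ?(ltW a0) // ler_pdivrMr // mul1r.
Qed.

(** A flat piece of the sphere does not lie on a line through the origin, since
    [rho] is not constant on such a segment.  Hence [p] and [q - p] form a
    basis, and a normal [n] to the segment reads off the coordinate along
    [p]. *)
Lemma flat_coordinates (R : realType) (rho : 'rV[R]_2 -> R)
    (n p q : 'rV[R]_2) :
  is_norm rho -> segment p q `<=` unit_sphere rho -> p <> q ->
  n <> 0 -> dot n (q - p) = 0 ->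
  dot n p != 0 /\
  forall v, exists b, v = (dot n v / dot n p) *: p + b *: (q - p).
Proof.
move=> hr hs pq n0 nw.
have w0 : q - p <> 0 by move=> /subr0_eq /esym.
have np : dot n p != 0.
  apply/eqP => np; have [t pE] := orthogonal_collinear n0 w0 np nw.
  have := flat_lower_bound 1 (- t) hr hs.
  by rewrite scale1r {1}pE -scalerDl subrr scale0r (is_norm0 hr); lra.
split=> // v.
have [|b bE] :=
  @orthogonal_collinear _ n (v - (dot n v / dot n p) *: p) _ n0 w0 _ nw.
  by rewrite !dotE divfK // subrr.
by exists b; rewrite -bE addrC subrK.
Qed.

(** The end is the last point of the line through [p] and [q] that stays in the
    unit ball.  If it is the midpoint of [v1] and [v2] in the ball, then by
    [flat_lower_bound] both have coordinate at most [1] along [p], hence exactly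
    [1]: they are on the line, and neither can be beyond the last point. *)
Lemma flat_end (R : realType) (rho : 'rV[R]_2 -> R) (p q : 'rV[R]_2) :
  is_norm rho -> segment p q `<=` unit_sphere rho -> p <> q ->
  exists2 t, 1 <= t & extreme_points (unit_ball rho) (p + t *: (q - p)).
Proof.
move=> hr hs pq.
have w0 : q - p <> 0 by move=> /subr0_eq /esym.
have rw := is_norm_gt0 hr w0.
pose S := [set t : R | rho (p + t *: (q - p)) <= 1].
have S1 : S 1.
  by rewrite /S /= scale1r addrC subrK (segment_sphere_ends hs).2.
have Sub : has_ubound S.
  exists (2 / rho (q - p)) => t St; rewrite ler_pdivlMr //.
  have := is_normD hr (p + t *: (q - p)) (- p).
  rewrite addrC addKr (is_normN hr) (is_normZ hr) (segment_sphere_ends hs).1.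
  have := ler_norm t; move: St; rewrite /S /=; nra.
have le_t t : S t -> t <= sup S by move=> St; exact: ub_le_sup.
exists (sup S); first exact: le_t.
have supS : rho (p + sup S *: (q - p)) <= 1.
  apply/ler_addgt0Pr => e e0.
  have [t St et] : exists2 t, S t & sup S - e / rho (q - p) < t.
    by apply: sup_adherent; [exact: divr_gt0|split=> //; exists 1].
  have := is_normD hr (p + t *: (q - p)) ((sup S - t) *: (q - p)).
  have -> : p + t *: (q - p) + (sup S - t) *: (q - p) = p + sup S *: (q - p)
    by row_ring.
  have tS := le_t _ St.
  rewrite (is_normZ hr) ger0_norm ?subr_ge0 //.
  have : (sup S - t) * rho (q - p) <= e by rewrite -ler_pdivlMr //; lra.
  by move: St; rewrite /S /=; lra.
split=> // v1 v2 h1 h2 vE.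
have [n n0 nw] := exists_normal w0.
have [np coord] := flat_coordinates hr hs pq n0 nw.
have [b1 v1E] := coord v1; have [b2 v2E] := coord v2.
have l1 := flat_lower_bound (dot n v1 / dot n p) b1 hr hs.
have l2 := flat_lower_bound (dot n v2 / dot n p) b2 hr hs.
rewrite -v1E in l1; rewrite -v2E in l2.
have sum1 : dot n v1 / dot n p + dot n v2 / dot n p = 2.
  rewrite -mulrDl -dotDr -vE mulr2n !dotDr !dotZr nw mulr0 addr0.
  by rewrite -mulr2n -(mulr_natl (dot n p) 2) mulfK.
rewrite /unit_ball /= in h1 h2.
have a1 : dot n v1 / dot n p = 1 by lra.
have a2 : dot n v2 / dot n p = 1 by lra.
rewrite a1 scale1r in v1E; rewrite a2 scale1r in v2E.
have t1 : b1 <= sup S by apply: le_t; rewrite /S /= -v1E.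
have t2 : b2 <= sup S by apply: le_t; rewrite /S /= -v2E.
have bE : (2 * sup S - b1 - b2) *: (q - p) = 0.
  transitivity ((p + sup S *: (q - p)) *+ 2
    - ((p + b1 *: (q - p)) + (p + b2 *: (q - p)))).
    by rewrite mulr2n; row_ring.
  by rewrite -v1E -v2E vE subrr.
move/eqP: bE; rewrite scaler_eq0 => /orP[/eqP bE|/eqP //].
rewrite v1E v2E; have -> : b1 = sup S by lra.
by have -> : b2 = sup S by lra.
Qed.

(** Prolonging a flat piece of the sphere at both ends until extreme points are
    met gives the edge of the unit ball that contains it. *)
Lemma flat_edge (R : realType) (rho : 'rV[R]_2 -> R) (p q : 'rV[R]_2) :
  is_norm rho -> segment p q `<=` unit_sphere rho -> p <> q ->
  exists x2 x3, [/\ extreme_points (unit_ball rho) x2,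
    extreme_points (unit_ball rho) x3, segment x2 x3 `<=` unit_sphere rho,
    x2 <> x3 & exists t, x2 - x3 = t *: (q - p)].
Proof.
move=> hr hs pq.
have w0 : q - p <> 0 by move=> /subr0_eq /esym.
have [t t1 Vt] := flat_end hr hs pq.
have [s s1 Vs] := flat_end hr (segment_sphereC hs) (nesym pq).
have dE : p + t *: (q - p) - (q + s *: (p - q)) = (t + s - 1) *: (q - p).
  by row_ring.
exists (p + t *: (q - p)), (q + s *: (p - q)); split=> //; last first.
- by exists (t + s - 1).
- move=> /eqP; rewrite -subr_eq0 dE scaler_eq0 => /orP[/eqP|/eqP //]; lra.
apply/segment_sphereP => u u01; apply/eqP; rewrite eq_le; apply/andP; split.
  by apply: is_norm_between_le => //; [case: Vt|case: Vs].
have -> : p + t *: (q - p) + u *: (q + s *: (p - q) - (p + t *: (q - p)))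
  = 1 *: p + (t - u * (t + s - 1)) *: (q - p) by row_ring.
exact: flat_lower_bound.
Qed.

(** * Two nearest points produce parallel edges *)

Lemma nearest_convex (R : realType) (n : nat) (rho : 'rV[R]_n -> R)
    (x0 x y : 'rV[R]_n) (t : R) :
  is_norm rho -> 0 <= t <= 1 -> nearest rho x0 x -> nearest rho x0 y ->
  nearest rho x0 (x + t *: (y - x)).
Proof.
move=> hr t01 [hx mx] [hy my]; split; first exact: dual_ball_convex.
move=> z hz; have -> : x0 - (x + t *: (y - x))
  = (x0 - x) + t *: ((x0 - y) - (x0 - x)) by row_ring.
by apply: is_norm_between_le; [| |exact: mx|exact: my].
Qed.

Lemma finite_gap_above (R : realFieldType) (l : R) (us : seq R) :
  (forall u, u \in us -> l < u) ->
  exists2 m, l < m & forall u, u \in us -> m <= u.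
Proof.
elim: us => [_|u us IH h]; first by exists (l + 1) => //; lra.
have [v hv|m lm hm] := IH; first by apply: h; rewrite inE hv orbT.
exists (Num.min m u); first by rewrite lt_min lm h // mem_head.
move=> v; rewrite inE => /orP[/eqP ->|/hm vm]; rewrite ge_min ?lexx ?orbT //.
by rewrite vm.
Qed.

(** A half-space that contains the generators contains their convex hull, which
    here is the unit ball; homogeneity then gives the bound everywhere. *)
Lemma hull_dual_ball (R : realType) (n : nat) (rho : 'rV[R]_n -> R)
    (A : set 'rV[R]_n) (y : 'rV[R]_n) :
  is_norm rho -> unit_ball rho = convex_hull A ->
  (forall a, A a -> dot a y <= 1) -> dual_ball rho y.
Proof.
move=> hr BA hA.
have hB b : rho b <= 1 -> dot b y <= 1.
  move=> hb; have : unit_ball rho b by [].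
  rewrite BA; apply: (@smallest_sub _ _ _ [set v | dot v y <= 1]) => // u v k.
  rewrite !inE => /= hu hv; rewrite !dotE /unstable.onem.
  have k0 : 0 <= k%:num by []. have k1 : k%:num <= 1 by [].
  have := between_le (t := k%:num) _ hv hu; rewrite k0 k1 => /(_ erefl); lra.
move=> x; have [->|/eqP x0] := eqVneq x 0; first by rewrite dot0l is_norm0.
have rx := is_norm_gt0 hr x0.
have := hB ((rho x)^-1 *: x).
rewrite is_normZ // dotZl gtr0_norm ?invr_gt0 // mulVf ?gt_eqF //.
by move=> /(_ (lexx _)); rewrite mulrC ler_pdivrMr // mul1r.
Qed.

(** If every generator of the unit ball had value less than [1] at [z], then,
    the generators being finite in number, [z] could be moved a little towards
    [x0] inside the dual ball, which would decrease the distance. *)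
Lemma nearest_touches (R : realType) (n : nat) (rho : 'rV[R]_n -> R)
    (A : set 'rV[R]_n) (x0 z : 'rV[R]_n) :
  is_norm rho -> finite_set A -> unit_ball rho = convex_hull A ->
  nearest rho x0 z -> 0 < rho (x0 - z) ->
  exists2 b, unit_ball rho b & 1 <= dot b z.
Proof.
move=> hr /finite_seqP[s As] BA [hz mz] d0.
apply: contrapT => /forall2NP hno.
have hs a : a \in s -> dot a z < 1.
  move=> sa; rewrite ltNge; apply/negP; have [] := hno a => //.
  by move=> nB; exfalso; apply: nB; rewrite BA As; exact: sub_gen_smallest.
(* The step [e] is at most [1] and small enough to keep the value at every
   generator at most [1]; the summand [1] in the denominators avoids a
   division by zero. *)
have [u|e e0 he] := @finite_gap_above _ 0
    (1 :: [seq (1 - dot a z) / (1 + `|dot a (x0 - z)|) | a <- s]).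
  rewrite inE => /orP[/eqP ->//|/mapP[a /hs az ->]].
  by rewrite divr_gt0 ?subr_gt0 // ltr_pwDl.
have e1 : e <= 1 by apply: he; rewrite mem_head.
have hze : dual_ball rho (z + e *: (x0 - z)).
  apply: hull_dual_ball hr BA _ => a; rewrite As => sa.
  have := he ((1 - dot a z) / (1 + `|dot a (x0 - z)|)).
  have -> : (1 - dot a z) / (1 + `|dot a (x0 - z)|) \in
      1 :: [seq (1 - dot a z) / (1 + `|dot a (x0 - z)|) | a <- s].
    by rewrite inE; apply/orP; right; apply/mapP; exists a.
  move=> /(_ erefl); rewrite ler_pdivlMr ?ltr_pwDl // (dotDr z) dotZr.
  by have := ler_norm (dot a (x0 - z)); nra.
have := mz _ hze.
have -> : x0 - (z + e *: (x0 - z)) = (1 - e) *: (x0 - z) by row_ring.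
by rewrite is_normZ // ger0_norm ?subr_ge0 //; nra.
Qed.

(** If [b] is the midpoint of [b1] and [b2], these two also reach the maximal
    value [1] at [x] and at [y].  Since [x] and [y] are linearly independent,
    this determines [b1]. *)
Lemma extreme_of_two_contacts (R : realType) (rho : 'rV[R]_2 -> R)
    (b x y : 'rV[R]_2) :
  dual_ball rho x -> dual_ball rho y -> x <> y -> unit_ball rho b ->
  dot b x = 1 -> dot b y = 1 -> extreme_points (unit_ball rho) b.
Proof.
move=> hx hy xy hb bx by1; split=> // b1 b2 h1 h2 bE.
rewrite /unit_ball /= in hb h1 h2.
have split1 z : dual_ball rho z -> dot b z = 1 -> dot b1 z = 1.
  move=> hz bz; have := hz b1; have := hz b2.
  have : dot (b *+ 2) z = dot (b1 + b2) z by rewrite bE.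
  by rewrite mulr2n !dotE bz; lra.
have b1E : b1 = b.
  have xy0 : x - y <> 0 by move=> /subr0_eq.
  have b0 : b <> 0 by move=> b0; move: bx; rewrite b0 dot0l; lra.
  have [||t tE] := @orthogonal_collinear _ (x - y) (b1 - b) b xy0 b0.
  - by rewrite !dotE !(dotC _ b) !(dotC _ b1) bx by1 !split1 //; ring.
  - by rewrite !dotE !(dotC _ b) bx by1; ring.
  have : dot (b1 - b) x = t * dot b x by rewrite tE dotZl.
  rewrite !dotE split1 // bx subrr mulr1 => /esym t0.
  by move: tE; rewrite t0 scale0r => /subr0_eq.
split=> //; rewrite b1E in bE.
by apply: (addrI b); rewrite -bE mulr2n.
Qed.

Lemma W_set_of_two_nearest (R : realType) (rho : 'rV[R]_2 -> R)
    (A : set 'rV[R]_2) (x0 x y : 'rV[R]_2) :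
  is_norm rho -> finite_set A -> unit_ball rho = convex_hull A ->
  nearest rho x0 x -> nearest rho x0 y -> x <> y -> W_set rho !=set0.
Proof.
move=> hr fA BA nx ny xy.
have dxy : rho (x0 - x) = rho (x0 - y).
  by apply/eqP; rewrite eq_le nx.2 ?ny.2 //; [case: nx|case: ny].
have d0 : 0 < rho (x0 - x).
  rewrite lt_neqAle (is_norm_ge0 hr) andbT eq_sym; apply/eqP => dx.
  case: hr => _ _ sep; apply: xy.
  have /subr0_eq <- := sep _ dx; rewrite dx in dxy.
  by have /subr0_eq := sep _ (esym dxy).
have same z : nearest rho x0 z -> rho (x0 - z) = rho (x0 - x).
  move=> nz; apply/eqP; rewrite eq_le nz.2 ?nx.2 //; [case: nz|case: nx] => //.
set d := rho (x0 - x) in dxy d0 same.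
have [||x2 [x3 [V2 V3 hs x23 [t tE]]]] :=
  @flat_edge _ rho (d^-1 *: (x0 - x)) (d^-1 *: (x0 - y)) hr.
- apply/segment_sphereP => t t01.
  have -> : d^-1 *: (x0 - x) + t *: (d^-1 *: (x0 - y) - d^-1 *: (x0 - x))
    = d^-1 *: (x0 - (x + t *: (y - x))) by row_ring.
  rewrite is_normZ // same; last exact: nearest_convex.
  by rewrite gtr0_norm ?invr_gt0 // mulVf ?gt_eqF.
- move=> /eqP; rewrite -subr_eq0 -scalerBr scaler_eq0 invr_eq0 gt_eqF //=.
  by move=> /eqP /subr0_eq /addrI /oppr_inj.
have half01 : 0 <= (2^-1 : R) <= 1 by lra.
have nz := nearest_convex hr half01 nx ny.
have [|b hb bz] := nearest_touches hr fA BA nz; first by rewrite same.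
have := nx.1 b; have := ny.1 b; move: (hb) bz; rewrite /unit_ball /= !dotE.
move=> hb' bz bx by1.
have bx1 : dot b x = 1 by lra.
have by2 : dot b y = 1 by lra.
exists (b, x2, x3); split; split=> //.
  exact: (extreme_of_two_contacts nx.1 ny.1).
by rewrite tE !dotE bx1 by2; ring.
Qed.

(** * Parallel edges produce two nearest points *)

(** Finitely many lower bounds, each strictly below each of finitely many upper
    bounds, leave room for an interval of positive length.  The inductions also
    cover empty lists, which have no maximum or minimum. *)
Lemma finite_gap (R : realFieldType) (ls us : seq R) :
  (forall l u, l \in ls -> u \in us -> l < u) ->
  exists l u, [/\ l < u, forall v, v \in ls -> v <= l
                       & forall v, v \in us -> u <= v].
Proof.
move=> h; suff [l hl lu] : exists2 l, forall v, v \in ls -> v <= l &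
    forall u, u \in us -> l < u.
  by have [u ? ?] := finite_gap_above lu; exists l, u.
elim: ls h => [_|l ls IH h].
  elim: us => [|u us [l _ hl]]; first by exists 0.
  exists (Num.min l (u - 1)) => // v.
  rewrite inE gt_min => /orP[/eqP ->|/hl ->//].
  by apply/orP; right; lra.
have [l' u hl' hu|m hm lu] := IH; first by apply: h; rewrite // inE hl' orbT.
exists (Num.max l m) => [v|u hu]; last by rewrite gt_max lu // h // mem_head.
by rewrite inE le_max => /orP[/eqP ->|/hm ->]; rewrite ?lexx ?orbT.
Qed.

(** Extremality is stated for midpoints; a strict convex combination is moved by
    a small amount both ways along the segment to become one. *)
Lemma extreme_strict_convex (R : realType) (n : nat) (rho : 'rV[R]_n -> R)
    (x u v : 'rV[R]_n) (s t : R) :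
  is_norm rho -> extreme_points (unit_ball rho) x ->
  unit_ball rho u -> unit_ball rho v -> 0 < s -> 0 < t ->
  (s + t) *: x = s *: u + t *: v -> u = x.
Proof.
move=> hr [hx ex] hu hv s0 t0 xE.
pose l := t / (s + t); pose e := Num.min l (1 - l).
have l0 : 0 < l by rewrite divr_gt0 // addr_gt0.
have l1 : 0 < 1 - l by rewrite subr_gt0 ltr_pdivrMr ?addr_gt0 //; lra.
have e0 : 0 < e by rewrite lt_min l0.
have el : e <= l by rewrite ge_min lexx.
have el1 : e <= 1 - l by rewrite ge_min lexx orbT.
have xuv : x = u + l *: (v - u).
  have st0 : s + t != 0 by rewrite gt_eqF // addr_gt0.
  apply: (scalerI st0); rewrite xE scalerDr scalerA mulrCA divff // mulr1.
  row_ring.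
have [|||xE1 _] := ex (u + (l - e) *: (v - u)) (u + (l + e) *: (v - u)).
- by apply: is_norm_between_le => //; lra.
- by apply: is_norm_between_le => //; lra.
- by rewrite {1}xuv mulr2n; row_ring.
have /eqP : e *: (v - u) = 0.
  transitivity (u + l *: (v - u) - (u + (l - e) *: (v - u))); first by row_ring.
  by rewrite -xE1 -xuv subrr.
rewrite scaler_eq0 gt_eqF //= => /eqP vu.
by rewrite xuv vu scaler0 addr0.
Qed.

(** In the orthogonal basis [(x, w)] write a generator of the ball as
    [a = al x + be w].  The point [x / |x|^2 + t w / |w|^2] has value
    [al + t be] at [a], and so belongs to the dual ball if and only if [t] is at
    most [(1 - al) / be] when [be > 0] and at least this quotient when [be < 0],
    for every generator [a]; when [be = 0], [al <= 1] is automatic.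
    Each lower bound is strictly below each upper bound: otherwise the segment
    between the two generators would cross the line of [x] at [c x] with
    [c >= 1], which contradicts that [x] is extreme. *)
Lemma dual_edge (R : realType) (rho : 'rV[R]_2 -> R) (A : set 'rV[R]_2)
    (x w : 'rV[R]_2) :
  is_norm rho -> finite_set A -> unit_ball rho = convex_hull A ->
  extreme_points (unit_ball rho) x -> x <> 0 -> w <> 0 -> dot x w = 0 ->
  exists p s, [/\ 0 < s, dual_ball rho p, dual_ball rho (p + s *: w)
               & dot x p = 1].
Proof.
move=> hr /finite_seqP[sA AE] BA ex x0 w0 xw.
have xx := dot2_gt0 x0; have ww := dot2_gt0 w0.
have xx0 := lt0r_neq0 xx; have ww0 := lt0r_neq0 ww.
pose al a := dot a x / dot x x; pose be a := dot a w / dot w w.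
have coord a : a = al a *: x + be a *: w.
  have [|t tE] := @orthogonal_collinear _ x (a - al a *: x) w x0 w0 _ xw.
    by rewrite !dotE (dotC x a) divfK // subrr.
  have : dot (a - al a *: x) w = t * dot w w by rewrite tE dotZl.
  rewrite !dotE xw mulr0 subr0 /be => ->; rewrite mulfK // -tE.
  row_ring.
have AB a : a \in sA -> unit_ball rho a.
  by move=> sa; rewrite BA AE; exact: sub_gen_smallest.
(* Beyond [x] on its ray there is no point of the ball, as [x] would be
   strictly between that point and the origin. *)
have multiple c : unit_ball rho (c *: x) -> c <= 1.
  move=> hc; rewrite leNgt; apply/negP => c1.
  have := @extreme_strict_convex _ _ rho x 0 (c *: x) (c - 1) 1 hr ex.
  move=> /(_ _ hc) h; apply: x0; rewrite -h //; [|lra|].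
  - by rewrite /unit_ball /= (is_norm0 hr) ler01.
  - by rewrite scaler0 add0r scale1r subrK.
have slopes l u : l \in [seq (1 - al a) / be a | a <- sA & be a < 0] ->
    u \in [seq (1 - al a) / be a | a <- sA & 0 < be a] -> l < u.
  move=> /mapP[a]; rewrite mem_filter => /andP[a0 sa ->].
  move=> /mapP[b]; rewrite mem_filter => /andP[b0 sb ->].
  (* [c x] is where the segment from [a] to [b] crosses the line of [x]. *)
  have ba0 : 0 < be b - be a by lra.
  pose c := (be b * al a - be a * al b) / (be b - be a).
  have cE : (be b - be a) *: (c *: x) = be b *: a + (- be a) *: b.
    transitivity (be b *: (al a *: x + be a *: w)
      + (- be a) *: (al b *: x + be b *: w)); last by rewrite -!coord.
    by rewrite scalerA mulrC divfK ?gt_eqF //; row_ring.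
  have hc : unit_ball rho (c *: x).
    rewrite /unit_ball /= -(ler_pM2l ba0) mulr1.
    rewrite -{1}(gtr0_norm ba0) -is_normZ // cE.
    apply: le_trans (is_normD hr _ _) _; rewrite !is_normZ //.
    rewrite (gtr0_norm b0) gtr0_norm; last lra.
    have := AB _ sa; have := AB _ sb; rewrite /unit_ball /=; nra.
  have c1 := multiple _ hc.
  have cN : c != 1.
    apply/eqP => cx; rewrite cx scale1r in cE.
    have Na0 : 0 < - be a by rewrite oppr_gt0.
    have ax := extreme_strict_convex hr ex (AB _ sa) (AB _ sb) b0 Na0 cE.
    by move: a0; rewrite ax /be xw mul0r ltxx.
  have {c1 cN}c1 : c < 1 by rewrite lt_neqAle cN.
  move: c1; rewrite /c ltr_pdivrMr // mul1r => c1.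
  rewrite ltr_pdivlMr // mulrAC ltr_ndivrMr //; lra.
have [l [u [lu hl hu]]] := finite_gap slopes.
have hK t : l <= t <= u ->
    dual_ball rho ((dot x x)^-1 *: x + (t / dot w w) *: w).
  move=> /andP[lt tu]; apply: hull_dual_ball hr BA _ => a; rewrite AE => /= sa.
  rewrite !dotE.
  have -> : (dot x x)^-1 * dot a x + t / dot w w * dot a w = al a + t * be a.
    by rewrite /al /be; ring.
  have [ba|ba|ba] := ltgtP (be a) 0.
  - have : (1 - al a) / be a <= l.
      by apply: hl; apply/mapP; exists a; rewrite // mem_filter ba.
    by rewrite ler_ndivrMr //; nra.
  - have : u <= (1 - al a) / be a.
      by apply: hu; apply/mapP; exists a; rewrite // mem_filter ba.
    by rewrite ler_pdivlMr //; nra.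
  - rewrite ba mulr0 addr0; apply: multiple.
    by have := AB _ sa; rewrite {1}(coord a) ba scale0r addr0.
exists ((dot x x)^-1 *: x + (l / dot w w) *: w), ((u - l) / dot w w); split.
- by rewrite divr_gt0 // subr_gt0.
- by apply: hK; rewrite lexx ltW.
- have -> : (dot x x)^-1 *: x + (l / dot w w) *: w + ((u - l) / dot w w) *: w
    = (dot x x)^-1 *: x + (u / dot w w) *: w by row_ring.
  by apply: hK; rewrite lexx ltW.
- by rewrite !dotE xw mulr0 addr0 mulVf.
Qed.

Lemma two_nearest_of_W_set (R : realType) (rho : 'rV[R]_2 -> R)
    (A : set 'rV[R]_2) :
  is_norm rho -> finite_set A -> unit_ball rho = convex_hull A ->
  W_set rho !=set0 ->
  exists x0 x y, [/\ nearest rho x0 x, nearest rho x0 y & x <> y].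
Proof.
move=> hr fA BA [[[x1 x2] x3] [[V1 V2 V3] [hs x23 orth]]].
have [r2 r3] := segment_sphere_ends hs.
have w0 : x2 - x3 <> 0 by move=> /subr0_eq.
(* The origin is the midpoint of [x2] and [- x2]. *)
have x10 : x1 <> 0.
  move=> x10; rewrite x10 in V1; case: V1 => _ /(_ x2 (- x2)) [].
  - by rewrite /unit_ball /= r2.
  - by rewrite /unit_ball /= is_normN // r2.
  - by rewrite subrr mul0rn.
  move=> x20 _; move: r2; rewrite -x20 (is_norm0 hr) => /esym/eqP.
  by rewrite oner_eq0.
have [p [s [s0 hp hq xp]]] := dual_edge hr fA BA V1 x10 w0 orth.
have orth' : dot x1 (x3 - x2) = 0 by rewrite -opprB dotNr orth oppr0.
have [m0 coord] := flat_coordinates hr hs x23 x10 orth'.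
have x13 : dot x1 x3 = dot x1 x2 by move: orth; rewrite !dotE; lra.
have x1r z : dual_ball rho z -> dot x1 z <= 1.
  by move=> hz; apply: le_trans (hz _) _; case: V1.
(* [x1 / (x1 . x2)] is the linear form with value [1] on the edge
   [[x2, x3]]. *)
have lower v : dot x1 v / dot x1 x2 <= rho v.
  by have [b {2}->] := coord v; exact: flat_lower_bound.
have qp : p <> p + s *: (x2 - x3).
  move=> /eqP; rewrite -subr_eq0 opprD addNKr oppr_eq0 scaler_eq0 gt_eqF //=.
  by move=> /eqP.
have [mp|mn] := ltP 0 (dot x1 x2).
- have far z : dual_ball rho z -> s <= rho (p + s *: x2 - z).
    move=> hz; apply: le_trans (lower _); rewrite ler_pdivlMr // !dotE xp.
    by have := x1r z hz; lra.
  exists (p + s *: x2), p, (p + s *: (x2 - x3)); split=> //; split=> // z hz.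
  + rewrite addrC addKr is_normZ // r2 mulr1 gtr0_norm //; exact: far.
  + have -> : p + s *: x2 - (p + s *: (x2 - x3)) = s *: x3 by row_ring.
    by rewrite is_normZ // r3 mulr1 gtr0_norm //; exact: far.
- have {}mn : dot x1 x2 < 0 by rewrite lt_neqAle m0.
  have far z : dual_ball rho z -> s <= rho (p - s *: x3 - z).
    move=> hz; rewrite -(is_normN hr); apply: le_trans (lower _).
    rewrite ler_ndivlMr // !dotE xp x13.
    by have := x1r z hz; lra.
  exists (p - s *: x3), p, (p + s *: (x2 - x3)); split=> //; split=> // z hz.
  + have -> : p - s *: x3 - p = (- s) *: x3 by row_ring.
    by rewrite is_normZ // r3 mulr1 normrN gtr0_norm //; exact: far.
  + have -> : p - s *: x3 - (p + s *: (x2 - x3)) = (- s) *: x2 by row_ring.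
    by rewrite is_normZ // r2 mulr1 normrN gtr0_norm //; exact: far.
Qed.

Unset Implicit Arguments.

Theorem theorem4p7 (R : realType) (rho : 'rV[R]_2 -> R)
    (rho_norm : is_norm rho)
    (rho_polyhedral : exists2 A : set 'rV[R]_2,
       finite_set A & unit_ball rho = convex_hull A) :
  (forall x0 : 'rV[R]_2, exists! x : 'rV[R]_2, is_solution rho x0 x)
  <-> W_set rho = set0.
Proof.
have [A fA BA] := rho_polyhedral; split=> [uniq_sol|W0 x0].
  apply: contrapT => /eqP/set0P hW.
  have [x0 [x [y [nx ny xy]]]] := two_nearest_of_W_set rho_norm fA BA hW.
  have [z [_ zuniq]] := uniq_sol x0; apply: xy.
  by rewrite -(zuniq x) ?(zuniq y) //; exact/is_solutionE.
have [x nx] := exists_nearest x0 rho_norm.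
exists x; split=> [|y /(is_solutionE _ _ rho_norm) ny].
  exact/is_solutionE.
apply: contrapT => xy; have := W_set_of_two_nearest rho_norm fA BA nx ny xy.
by rewrite W0 => -[].
Qed.
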